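(* Consider the stochastic time-varying problem and the prediction-correction iterates $\hat{\bm x}_k,\bm x_k$ described in the context. Let $\sigma_1\ge 0$, $\mu>0$, $L_{2,0}>0$ be constants and suppose: (1) $\mathbb E_{\bm y\sim\mathcal P(t)}[\ell(\bm x;\bm y)]$ and $\mathbb E_{\bm y\sim\mathcal P(t)}[\|\nabla_{\bm x}\ell(\bm x;\bm y)\|]$ exist for all $\bm x\in\mathbb R^d$ and $t\ge 0$; (2) $\mathbb E_{\bm y\sim\mathcal P(t_k)}\big[\|\nabla_{\bm x}\ell(\bm x_k^\ast;\bm y)-\mathbb E_{\bm z\sim\mathcal P(t_k)}[\nabla_{\bm x}\ell(\bm x_k^\ast;\bm z)]\|^2\big]\le\sigma_1^2$ for all $k\ge 0$; (3) $\ell(\cdot;\bm y)$ is $\mu$-strongly convex for any $\bm y$, i.e., for all $\bm x,\bm x'\in\mathbb R^d$, $\bm y\in\mathbb R^{d_y}$: $\ell(\bm x;\bm y)\ge \ell(\bm x';\bm y)+\langle\nabla_{\bm x}\ell(\bm x';\bm y),\bm x-\bm x'\rangle+\frac{\mu}{2}\|\bm x-\bm x'\|^2$; (4) $\ell(\cdot;\bm y)$ is $L_{2,0}$-smooth for any $\bm y$, i.e., for all $\bm x,\bm x'\in\mathbb R^d$, $\bm y\in\mathbb R^{d_y}$: $\ell(\bm x;\bm y)\le \ell(\bm x';\bm y)+\langle\nabla_{\bm x}\ell(\bm x';\bm y),\bm x-\bm x'\rangle+\frac{L_{2,0}}{2}\|\bm x-\bm x'\|^2$; (5) $\psi$ is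 proper, closed and convex. Let further $\gamma\in[0,\|\bm\alpha\|_1^{-1})$ and $\Delta_1,\Delta_2,\Delta_3\ge 0$ be constants such that: (6) $\|\bm x_k-\hat{\bm x}_k^\ast\|\le\gamma\|\hat{\bm x}_k-\hat{\bm x}_k^\ast\|$ for all $k\ge 0$; (7) $\|\mathbb E[\hat{\bm x}_k^\ast]-\bm x_k^\ast\|\le\Delta_1$ and $\mathbb E[\|\hat{\bm x}_k^\ast-\bm x_k^\ast\|^2]\le\Delta_2^2$ for all $k\ge 0$; (8) $\|X_k^\ast\bm\alpha-\bm x_k^\ast\|\le\Delta_3$ for all $k\ge 0$. Let $e_k:=\mathbb E[\|\hat{\bm x}_k-\bm x_k^\ast\|]$. Then there exists $C\ge 0$ such that $$e_k\le\frac{\|\bm\alpha\|_1\Delta_1+(\gamma\|\bm\alpha\|_1+\|\bm\alpha\|)\Delta_2+\Delta_3}{1-\gamma\|\bm\alpha\|_1}+C(\gamma\|\bm\alpha\|_1)^{k/n}$$ for all $k\ge 0$, and therefore $$\limsup_{k\to\infty}e_k\le\frac{\|\bm\alpha\|_1\Delta_1+(\gamma\|\bm\alpha\|_1+\|\bm\alpha\|)\Delta_2+\Delta_3}{1-\gamma\|\bm\alpha\|_1}.$$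
   Context: Norms: $\|\cdot\|$ is the Euclidean norm and $\|\cdot\|_1$ the $\ell_1$-norm. Problem: for each $t\ge 0$, $\mathcal P(t)$ is a probability distribution on $\mathbb R^{d_y}$; $\ell:\mathbb R^d\times\mathbb R^{d_y}\to\mathbb R$ is a loss function, differentiable in its first argument; $\psi:\mathbb R^d\to\mathbb R\cup\{\infty\}$ is a regularization function. Set $f(\bm x;t):=\mathbb E_{\bm y\sim\mathcal P(t)}[\ell(\bm x;\bm y)]+\psi(\bm x)$ and $\bm x^\ast(t):=\mathrm{argmin}_{\bm x\in\mathbb R^d}f(\bm x;t)$ (unique by strong convexity). Fix a sampling period $h>0$, let $t_k:=kh$ and $\bm x_k^\ast:=\bm x^\ast(t_k)$ for $k\ge 0$. At each time $t_k$, $k=0,1,\ldots$, a sample $\bm y_k\sim\mathcal P(t_k)$ is drawn. Set $\hat\ell_k(\bm x):=\ell(\bm x;\bm y_k)$, $\hat f_k:=\hat\ell_k+\psi$, and $\hat{\bm x}_k^\ast:=\mathrm{argmin}_{\bm x\in\mathbb R^d}\hat f_k(\bm x)$ (unique by strong convexity), a random vector depending only on $\bm y_k$. Coefficients: let $p\le n$ be positive integers and $\bm\phi:\mathbb R\to\mathbb R^p$ a function such that $\Phi:=(\bm\phi(-1)\ \cdots\ \bm\phi(-n))\in\mathbb R^{p\times n}$ has full row rank. Set $\bm\alpha:=\Phi^\top(\Phi\Phi^\top)^{-1}\bm\phi(0)\in\mathbb R^n$. Algorithm (Stochastic SHARP): given $\bm x_0\in\mathbb R^d$, set $\bm x_{-n+1}=\cdots=\bm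 x_{-1}=\bm x_0$ and $\hat{\bm x}_0:=\bm x_0$. For $k=1,2,\ldots$: (prediction) $\hat{\bm x}_k:=X_k\bm\alpha$ with $X_k:=(\bm x_{k-1}\ \cdots\ \bm x_{k-n})\in\mathbb R^{d\times n}$; (correction) $\bm x_k$ is an approximate solution of $\min_{\bm x}\hat f_k(\bm x)$ (for example, obtained by proximal gradient steps started at $\hat{\bm x}_k$). Also $X_k^\ast:=(\bm x_{k-1}^\ast\ \cdots\ \bm x_{k-n}^\ast)\in\mathbb R^{d\times n}$; where a negative index $j$ occurs, $\bm x_j^\ast$ stands for a fixed vector of $\mathbb R^d$.
   Formalization: The first estimate is not claimed for γ = 0 and 0 < k < n: there C(γ‖α‖₁)^{k/n} = 0 and the bound can fail, since x_{-1},…,x_{-n+1} are unrelated to the fixed vectors x*_j of negative index; the limsup bound is unrestricted. *)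

(* Defs.v *)
From mathcomp Require Import all_boot all_order all_algebra.
From mathcomp Require Import all_classical all_reals all_analysis.

Set Implicit Arguments.
Unset Strict Implicit.
Unset Printing Implicit Defensive.

Import Order.TTheory GRing.Theory Num.Theory.
Import numFieldNormedType.Exports.

Local Open Scope classical_set_scope.
Local Open Scope ring_scope.

(* The library norm `|v| on 'cV[R]_d is the sup norm, hence the explicit
   Euclidean and l1 norms below. *)
Definition dotv (R : realType) (d : nat) (u v : 'cV[R]_d) : R :=
  \sum_(i < d) u i 0 * v i 0.

Definition enorm (R : realType) (d : nat) (v : 'cV[R]_d) : R :=
  Num.sqrt (\sum_(i < d) v i 0 ^+ 2).

Definition norm1 (R : realType) (d : nat) (v : 'cV[R]_d) : R :=
  \sum_(i < d) `|v i 0|.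

(* Vector of partial derivatives; it is the gradient wherever g is
   differentiable. *)
Definition grad (R : realType) (d : nat) (g : 'cV[R]_d -> R) (x : 'cV[R]_d) :
    'cV[R]_d :=
  \col_(i < d) 'D_(delta_mx i 0) g x.

(* R^d with its Borel sigma-algebra; convertible to 'cV[R]_d. *)
Notation borelVec R d := (g_sigma_algebraType (@open 'cV[R]_d)).

(* fine maps infinite expectations to 0, so this is the expectation of X only
   if the components of X are integrable. *)
Definition vexpect (disp : measure_display) (T : measurableType disp)
    (R : realType) (d : nat) (Q : probability T R) (X : T -> 'cV[R]_d) :
    'cV[R]_d :=
  \col_(i < d) fine 'E_Q[fun w => X w i 0].

Definition mutually_independent (disp : measure_display)
    (T : measurableType disp) (R : realType) (Q : probability T R)
    (disp' : measure_display) (S : measurableType disp')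
    (Y : nat -> T -> S) : Prop :=
  forall (J : seq nat) (A : nat -> set S), uniq J ->
    (forall k, measurable (A k)) ->
    Q (\bigcap_(k in [set k | k \in J]) (Y k @^-1` A k)) =
    (\prod_(k <- J) Q (Y k @^-1` A k))%E.

Definition has_law (disp : measure_display) (T : measurableType disp)
    (R : realType) (Q : probability T R)
    (disp' : measure_display) (S : measurableType disp')
    (Y : T -> S) (law : probability S R) : Prop :=
  measurable_fun setT Y /\
  forall A : set S, measurable A -> Q (Y @^-1` A) = law A.

(* Uniqueness of the minimizer is not part of the definition. *)
Definition is_argmin (R : realType) (T : Type) (g : T -> \bar R) (x : T) :
    Prop :=
  forall z, (g x <= g z)%E.

Definition proper_fun (R : realType) (d : nat) (psi : 'cV[R]_d -> \bar R) :
    Prop :=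
  (forall x, psi x != -oo%E) /\ (exists x, psi x != +oo%E).

(* Closedness of the epigraph. *)
Definition closed_fun (R : realType) (d : nat) (psi : 'cV[R]_d -> \bar R) :
    Prop :=
  closed [set q : 'cV[R]_d * R | (psi q.1 <= q.2%:E)%E].

(* No oo - oo can occur for a proper psi, and 0 * +oo = 0 in \bar R. *)
Definition convex_fun (R : realType) (d : nat) (psi : 'cV[R]_d -> \bar R) :
    Prop :=
  forall (x z : 'cV[R]_d) (s : R), 0 <= s <= 1 ->
    (psi (s *: x + (1 - s) *: z)%R <= s%:E * psi x + (1 - s)%:E * psi z)%E.

Definition strongly_convex (R : realType) (d : nat) (mu : R)
    (g : 'cV[R]_d -> R) : Prop :=
  forall x x', g x >= g x' + dotv (grad g x') (x - x')
                      + mu / 2 * enorm (x - x') ^+ 2.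

Definition smooth (R : realType) (d : nat) (L : R) (g : 'cV[R]_d -> R) :
    Prop :=
  forall x x', g x <= g x' + dotv (grad g x') (x - x')
                      + L / 2 * enorm (x - x') ^+ 2.

Definition objective (R : realType) (d dy : nat)
    (P : R -> probability (borelVec R dy) R)
    (l : 'cV[R]_d -> 'cV[R]_dy -> R) (psi : 'cV[R]_d -> \bar R)
    (t : R) (x : 'cV[R]_d) : \bar R :=
  ('E_(P t)[l x] + psi x)%E.

Definition sample_objective (R : realType) (d dy : nat)
    (l : 'cV[R]_d -> 'cV[R]_dy -> R) (psi : 'cV[R]_d -> \bar R)
    (y : 'cV[R]_dy) (x : 'cV[R]_d) : \bar R :=
  ((l x y)%:E + psi x)%E.

(* Columns are counted from 0: column j is phi (-(j + 1)). *)
Definition Phi_mx (R : realType) (p n : nat) (phi : R -> 'cV[R]_p) :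
    'M[R]_(p, n) :=
  \matrix_(i < p, j < n) phi (- j.+1%:R) i 0.

Definition coef (R : realType) (p n : nat) (phi : R -> 'cV[R]_p) :
    'cV[R]_n :=
  let Phi := Phi_mx n phi in Phi^T *m invmx (Phi *m Phi^T) *m phi 0.

(* (u_{k-1} ... u_{k-n}), for a sequence indexed by int since k - n may be
   negative. *)
Definition history (R : realType) (d n : nat) (u : int -> 'cV[R]_d)
    (k : nat) : 'M[R]_(d, n) :=
  \matrix_(i < d, j < n) u (k%:Z - j.+1%:Z) i 0.

Definition prediction (R : realType) (d n : nat) (alpha : 'cV[R]_n)
    (u : int -> 'cV[R]_d) (k : nat) : 'cV[R]_d :=
  if k is 0%N then u 0 else history n u k *m alpha.

(* Main.v *)
Require Import Defs.
From mathcomp Require Import all_boot all_order all_algebra.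
From mathcomp Require Import all_classical all_reals all_analysis.
From mathcomp Require Import measurable_realfun zify ring lra.

(* Write e_k for E|xhat_k - x*_k| and split, for k >= n,
     xhat_k - x*_k = sum_j alpha_j (x_{k-j} - xhat*_{k-j})
                   + sum_j alpha_j (xhat*_{k-j} - x*_{k-j}) + (X*_k alpha - x*_k).
   The last term is at most Delta3, and the first has mean norm at most
   gamma sum_j |alpha_j| (e_{k-j} + Delta2). The middle one is a bias of norm at
   most |alpha|_1 Delta1 plus a sum of independent centred vectors, whose second
   moments add up, so that its mean norm is at most |alpha| Delta2. The resulting
   recursion e_k <= gamma sum_j |alpha_j| e_{k-j} + B has fixed point
   B / (1 - gamma |alpha|_1) and contracts by gamma |alpha|_1 over any n
   consecutive steps. *)

Set Implicit Arguments.
Unset Strict Implicit.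
Unset Printing Implicit Defensive.

Import Order.TTheory GRing.Theory Num.Theory.
Import numFieldNormedType.Exports.
Local Open Scope classical_set_scope.
Local Open Scope ring_scope.

(** * Euclidean and l1 norms of column vectors *)

Section EuclideanNorm.
Context {R : realType}.
Implicit Types (d n k : nat).

Lemma enorm_ge0 d (u : 'cV[R]_d) : 0 <= enorm u.
Proof. exact: sqrtr_ge0. Qed.

Lemma sqr_enorm d (u : 'cV[R]_d) : enorm u ^+ 2 = \sum_(i < d) u i 0 ^+ 2.
Proof. by rewrite sqr_sqrtr// sumr_ge0// => i _; exact: sqr_ge0. Qed.

Lemma norm1_ge0 n (a : 'cV[R]_n) : 0 <= norm1 a.
Proof. exact: sumr_ge0. Qed.

Lemma enorm0 d : enorm (0 : 'cV[R]_d) = 0.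
Proof. by rewrite /enorm big1 ?sqrtr0// => i _; rewrite mxE expr0n. Qed.

Lemma enormZ d (c : R) (u : 'cV[R]_d) : enorm (c *: u) = `|c| * enorm u.
Proof.
rewrite /enorm -sqrtr_sqr -sqrtrM ?sqr_ge0//; congr Num.sqrt.
by rewrite mulr_sumr; apply: eq_bigr => i _; rewrite mxE exprMn.
Qed.

Lemma enormN d (u : 'cV[R]_d) : enorm (- u) = enorm u.
Proof. by rewrite -scaleN1r enormZ normrN normr1 mul1r. Qed.

Lemma ler_coord_enorm d (u : 'cV[R]_d) i : `|u i 0| <= enorm u.
Proof.
rewrite -sqrtr_sqr ler_sqrt; last by apply: sumr_ge0 => j _; exact: sqr_ge0.
by rewrite (bigD1 i)//= lerDl sumr_ge0// => j _; exact: sqr_ge0.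
Qed.

Lemma enorm_eq0_coord d (u : 'cV[R]_d) i : enorm u = 0 -> u i 0 = 0.
Proof.
by move=> u0; apply/eqP; rewrite -normr_le0 -u0 ler_coord_enorm.
Qed.

(** Cauchy-Schwarz. The squared coordinates of |v| u - |u| v have the nonnegative sum 2 |u| |v| (|u|
    |v| - <u, v>); zero norms are treated first so that the factor 2 |u| |v| can be cancelled. *)
Lemma dotv_le_enormM d (u v : 'cV[R]_d) : dotv u v <= enorm u * enorm v.
Proof.
have [v0|v0] := eqVneq (enorm v) 0.
  by rewrite v0 mulr0 /dotv big1// => i _; rewrite (enorm_eq0_coord i v0) mulr0.
have [u0|u0] := eqVneq (enorm u) 0.
  by rewrite u0 mul0r /dotv big1// => i _; rewrite (enorm_eq0_coord i u0) mul0r.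
have vp : 0 < enorm v by rewrite lt_neqAle eq_sym v0 enorm_ge0.
have up : 0 < enorm u by rewrite lt_neqAle eq_sym u0 enorm_ge0.
have : 0 <= \sum_(i < d) (enorm v * u i 0 - enorm u * v i 0) ^+ 2.
  by apply: sumr_ge0 => i _; exact: sqr_ge0.
have -> : \sum_(i < d) (enorm v * u i 0 - enorm u * v i 0) ^+ 2 =
  2 * (enorm u * enorm v) * (enorm u * enorm v - dotv u v).
  transitivity (enorm v ^+ 2 * enorm u ^+ 2 + enorm u ^+ 2 * enorm v ^+ 2
     - 2 * enorm u * enorm v * dotv u v); last by ring.
  rewrite [in enorm v ^+ 2 * enorm u ^+ 2](sqr_enorm u).
  rewrite [in enorm u ^+ 2 * enorm v ^+ 2](sqr_enorm v).
  rewrite !mulr_sumr -big_split/= -sumrB; apply: eq_bigr => i _; ring.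
by rewrite pmulr_rge0 ?subr_ge0// !mulr_gt0.
Qed.

Lemma enormD d (u v : 'cV[R]_d) : enorm (u + v) <= enorm u + enorm v.
Proof.
rewrite -(@ler_pXn2r _ 2)// ?nnegrE ?addr_ge0 ?enorm_ge0//.
rewrite sqrrD !sqr_enorm.
have -> : \sum_(i < d) (u + v) i 0 ^+ 2 =
   \sum_(i < d) u i 0 ^+ 2 + 2 * dotv u v + \sum_(i < d) v i 0 ^+ 2.
  rewrite /dotv mulr_sumr -!big_split/=; apply: eq_bigr => i _.
  by rewrite mxE; ring.
by rewrite lerD2r lerD2l mulr_natl lerMn2r dotv_le_enormM orbT.
Qed.

Lemma enormB d (u v w : 'cV[R]_d) : enorm (u - w) <= enorm (u - v) + enorm (v - w).
Proof. by rewrite -[u - w](subrKA v) enormD. Qed.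

Lemma enorm_sum d n (u : 'I_n -> 'cV[R]_d) :
  enorm (\sum_(j < n) u j) <= \sum_(j < n) enorm (u j).
Proof.
apply: (big_ind2 (fun x y => enorm x <= y)) => //; first by rewrite enorm0.
by move=> x1 x2 y1 y2 h1 h2; rewrite (le_trans (enormD _ _))// lerD.
Qed.

Lemma history_mulmx d n (u : int -> 'cV[R]_d) k (a : 'cV[R]_n) :
  history n u k *m a = \sum_(j < n) a j 0 *: u (k%:Z - j.+1%:Z).
Proof.
apply/matrixP => i j; rewrite !mxE summxE; apply: eq_bigr => l _.
by rewrite (ord1 j) !mxE mulrC.
Qed.

End EuclideanNorm.

(** * Measurability, moments and independence *)

Section RandomVectors.
Context {disp : measure_display} {T : measurableType disp} {R : realType}.
Variable Q : probability T R.
Implicit Types (X Y : T -> R) (d n : nat).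

Lemma measurable_coord d (i : 'I_d) :
  measurable_fun setT ((fun v : 'cV[R]_d => v i 0) : borelVec R d -> R).
Proof.
apply: (measurability _ (RGenOpens.measurableE R)).
move=> _ [_ [a [b ->] <-]]; rewrite setTI; apply: sub_sigma_algebra => /=.
have /continuousP/(_ _ (interval_open _ _)) := @coord_continuous R d 1 i 0.
by apply.
Qed.

Lemma measurable_enorm d (f : T -> 'cV[R]_d) :
  (forall i, measurable_fun setT (fun w => f w i 0)) ->
  measurable_fun setT (fun w => enorm (f w)).
Proof.
move=> mf; apply: (measurableT_comp (continuous_measurable_fun (@sqrt_continuous R))).
by apply: measurable_sum => i; exact: measurable_funX.
Qed.

Lemma Lfun2_of_sqr_lty X : measurable_fun setT X ->
  ('E_Q[fun w => (X w ^+ 2)%R] < +oo)%E -> X \in Lfun Q 2%:E.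
Proof.
rewrite unlock => mX fX; rewrite inE; apply/andP; split; rewrite inE//=.
rewrite /finite_norm unlock poweR_lty//=.
by under eq_integral do rewrite powR_mulrn// real_normK ?num_real//.
Qed.

Lemma Lfun2_Lfun1 X : X \in Lfun Q 2%:E -> X \in Lfun Q 1.
Proof. by apply: Lfun_subset12; exact: fin_num_measure. Qed.

(** Independence makes the joint law of [X] and [Y] the product of their laws, over which Fubini's
    theorem factors the integral of the product. *)
Lemma expectation_mul_indep X Y :
  X \in Lfun Q 1 -> Y \in Lfun Q 1 -> (X * Y)%R \in Lfun Q 1 ->
  (forall A B, measurable A -> measurable B ->
    Q (X @^-1` A `&` Y @^-1` B) = (Q (X @^-1` A) * Q (Y @^-1` B))%E) ->
  ('E_Q[X * Y] = 'E_Q[X] * 'E_Q[Y])%E.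
Proof.
move=> X1 Y1 XY1 indep.
have /andP[+ _] := X1; rewrite inE/= => mX.
have /andP[+ _] := Y1; rewrite inE/= => mY.
have EY := expectation_fin_num Y1.
move: X1 Y1 XY1 => /Lfun1_integrable iX /Lfun1_integrable iY /Lfun1_integrable iXY.
have mXY : measurable_fun setT (fun w => (X w, Y w)) by exact: measurable_fun_pair.
pose X' : {mfun T >-> R} :=
  MeasurableFun.Pack (MeasurableFun.Class (isMeasurableFun.Build _ _ _ _ X mX)).
pose Y' : {mfun T >-> R} :=
  MeasurableFun.Pack (MeasurableFun.Class (isMeasurableFun.Build _ _ _ _ Y mY)).
pose Z' : {mfun T >-> (R * R)%type} :=
  MeasurableFun.Pack (MeasurableFun.Class (isMeasurableFun.Build _ _ _ _ _ mXY)).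
pose f (z : R * R) : \bar R := (z.1 * z.2)%:E.
have mf : measurable_fun setT f.
  by apply/measurable_EFinP; apply: measurable_funM.
(* A product measure is determined by its values on rectangles, and on these the equality is
   [indep]. *)
have lawE A : measurable A ->
    (distribution Q X' \x distribution Q Y')%E A = distribution Q Z' A.
  apply: product_measure_unique => A' B' mA' mB'.
  by rewrite /distribution /pushforward/= -indep.
have prodE g : (\int[distribution Q X' \x distribution Q Y']_z g z =
    \int[distribution Q Z']_z g z)%E.
  by apply: eq_measure_integral => A mA _; exact: lawE.
have iZ : (distribution Q Z').-integrable setT f by exact: integrable_pushforward.
have iP : (distribution Q X' \x distribution Q Y')%E.-integrable setT f.
  by apply/integrableP; split => //; rewrite prodE; have /integrableP[] := iZ.
have -> : ('E_Q[X * Y] = \int[distribution Q Z']_z f z)%E.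
  by rewrite unlock integral_pushforward.
rewrite -prodE -integral12_prod_meas1// /fubini_F.
transitivity (\int[distribution Q X']_x (x%:E * 'E_Q[Y]))%E.
  apply: eq_integral => x _; rewrite unlock.
  rewrite -(@integral_distribution _ _ _ _ _ _ Y' EFin)//.
  rewrite -integralZl//; exact: integrable_pushforward.
rewrite integral_distribution//=; last 2 first.
- by apply: emeasurable_funM => //; exact: measurable_cst.
- by rewrite -(fineK EY); apply: integrableZr.
by rewrite -(fineK EY) integralZr// unlock.
Qed.

Lemma covariance_indep X Y :
  X \in Lfun Q 2%:E -> Y \in Lfun Q 2%:E ->
  (forall A B, measurable A -> measurable B ->
    Q (X @^-1` A `&` Y @^-1` B) = (Q (X @^-1` A) * Q (Y @^-1` B))%E) ->
  covariance Q X Y = 0%E.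
Proof.
move=> X2 Y2 XY; have X1 := Lfun2_Lfun1 X2; have Y1 := Lfun2_Lfun1 Y2.
have XY1 := Lfun2_mul_Lfun1 X2 Y2.
rewrite covarianceE// expectation_mul_indep// subee//.
by rewrite fin_numM// expectation_fin_num.
Qed.

Lemma covariance_sumr n (X : T -> R) (Y : 'I_n -> T -> R) :
  X \in Lfun Q 2%:E -> (forall j, Y j \in Lfun Q 2%:E) ->
  covariance Q X (\sum_(j < n) Y j) = (\sum_(j < n) covariance Q X (Y j))%E.
Proof.
move=> X2; elim: n Y => [|n IH] Y Y2.
  by rewrite !big_ord0; exact: covariance_cst_r.
rewrite !big_ord_recl covarianceDr//; first by rewrite IH.
by apply: rpred_sum => *; rewrite ?lee1n.
Qed.

Lemma variance_sum_uncorrelated n (X : 'I_n -> T -> R) :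
  (forall j, X j \in Lfun Q 2%:E) ->
  (forall i j, i != j -> covariance Q (X i) (X j) = 0%E) ->
  variance Q (\sum_(j < n) X j) = (\sum_(j < n) variance Q (X j))%E.
Proof.
elim: n X => [|n IH] X X2 cX.
  by rewrite !big_ord0; exact: variance_cst.
rewrite !big_ord_recl varianceD//; last by apply: rpred_sum => *; rewrite ?lee1n.
rewrite covariance_sumr// IH// => [|i j ij]; last exact: cX.
by rewrite [X in (_ + _ * X)%E]big1 ?mule0 ?adde0// => j _; exact: cX.
Qed.

(** Subtracting [c] leaves the variance unchanged, and a variance is the second moment minus the
    square of the mean. *)
Lemma variance_le_sqr_dev X (c : R) : X \in Lfun Q 2%:E ->
  (variance Q X <= 'E_Q[fun w => ((X w - c) ^+ 2)%R])%E.
Proof.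
move=> X2; have X2c : X \- cst c \in Lfun Q 2%:E.
  by rewrite rpredB ?lee1n// => h; exact: Lfun_cst.
rewrite -(varianceB_cst_r c X2) varianceE// -[leRHS]sube0 leeB// sqre_ge0//.
Qed.

(* AM-GM with parameter t: [f <= (f^2 / t + t) / 2] *)
Lemma expectation_le_of_sqr X (c : R) : 0 <= c -> measurable_fun setT X ->
  (forall w, 0 <= X w) ->
  ('E_Q[fun w => (X w ^+ 2)%R] <= (c ^+ 2)%:E -> 'E_Q[X] <= c%:E)%E.
Proof.
move=> c0 mX X0 Xc; apply/lee_addgt0Pr => eps eps0.
(* The slack [eps] keeps t = c + eps positive even for c = 0; as c <= t, the mean is at most (c^2 /
   t + t) / 2 <= t. *)
have t0 : 0 < c + eps by rewrite ltr_wpDl.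
set t := c + eps in t0 *.
have X2 : X \in Lfun Q 2%:E.
  by apply: Lfun2_of_sqr_lty => //; exact: le_lt_trans Xc (ltry _).
have XX1 := Lfun2_mul_Lfun1 X2 X2.
have le1 : ('E_Q[X] <= 'E_Q[(((2 * t)^-1 \o* (X \* X)) \+ cst (t / 2))%R])%E.
  apply: expectation_le => //.
  - by apply: measurable_funD => //; apply: measurable_funM => //; apply: measurable_funM.
  - by move=> w /=; rewrite addr_ge0// ?mulr_ge0// ?invr_ge0 ?mulr_ge0 ?X0 ?ltW.
  - apply: aeW => w /=; rewrite -subr_ge0.
    have -> : X w * X w * (2 * t)^-1 + t / 2 - X w = (X w - t) ^+ 2 / (2 * t).
      by field; rewrite gt_eqF.
    by rewrite divr_ge0 ?sqr_ge0// mulr_ge0// ltW.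
apply: (le_trans le1).
rewrite expectationD ?Lfun_scale ?Lfun_cst// expectationZl// expectation_cst.
have -> : ('E_Q[(X \* X)%R])%E = ('E_Q[fun w => (X w ^+ 2)%R])%E by [].
apply: (@le_trans _ _ ((2 * t)^-1%:E * (c ^+ 2)%:E + (t / 2)%:E)%E).
  by rewrite leeD2r// lee_pmul2l// ?lte_fin ?invr_gt0 ?mulr_gt0.
rewrite -EFinM -EFinD lee_fin -/t.
rewrite [leRHS](_ : t = (2 * t)^-1 * t ^+ 2 + t / 2); last by field; rewrite gt_eqF.
rewrite lerD2r ler_pM2l ?invr_gt0 ?mulr_gt0// ler_pXn2r ?nnegrE// ?ltW//.
by rewrite /t ltrDl.
Qed.

(** Nonnegativity takes the place of integrability: the expectations may be infinite. *)
Lemma expectation_sum_ge0 n (F : 'I_n -> T -> R) :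
  (forall j, measurable_fun setT (F j)) -> (forall j w, 0 <= F j w) ->
  ('E_Q[fun w => (\sum_(j < n) F j w)%R] = \sum_(j < n) 'E_Q[F j])%E.
Proof.
move=> mF F0; rewrite unlock.
under eq_integral do rewrite -sumEFin.
rewrite ge0_integral_sum//=; first by move=> j; exact/measurable_EFinP.
by move=> j w _; rewrite lee_fin.
Qed.

Lemma expectationZ_le X (c b : R) : 0 <= c -> measurable_fun setT X ->
  (forall w, 0 <= X w) ->
  ('E_Q[X] <= b%:E -> 'E_Q[fun w => (c * X w)%R] <= (c * b)%:E)%E.
Proof.
move=> c0 mX X0; rewrite unlock => Xb.
under eq_integral do rewrite EFinM.
rewrite ge0_integralZl_EFin//; last 2 first.
- by move=> w _; rewrite lee_fin.
- exact/measurable_EFinP.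
by rewrite EFinM lee_wpmul2l ?lee_fin.
Qed.

Lemma expectation_weighted_sum_le n (c b : 'I_n -> R) (F : 'I_n -> T -> R) :
  (forall j, 0 <= c j) -> (forall j, measurable_fun setT (F j)) ->
  (forall j w, 0 <= F j w) -> (forall j, 'E_Q[F j] <= (b j)%:E)%E ->
  ('E_Q[fun w => (\sum_(j < n) c j * F j w)%R] <= (\sum_(j < n) c j * b j)%:E)%E.
Proof.
move=> c0 mF F0 Fb; rewrite expectation_sum_ge0.
- by rewrite -sumEFin; apply: lee_sum => j _; exact: expectationZ_le.
- by move=> j; exact: measurable_funM.
- by move=> j w; rewrite mulr_ge0.
Qed.

End RandomVectors.

(** * Mean norm of a weighted sum of independent random vectors *)

Section WeightedNoise.
Context {disp : measure_display} {T : measurableType disp} {R : realType}.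
Variable Q : probability T R.
Implicit Types (X Y : T -> R) (d n : nat).

Lemma expectationD_le X Y (a b : R) :
  measurable_fun setT X -> measurable_fun setT Y ->
  (forall w, 0 <= X w) -> (forall w, 0 <= Y w) ->
  ('E_Q[X] <= a%:E -> 'E_Q[Y] <= b%:E ->
   'E_Q[fun w => (X w + Y w)%R] <= (a + b)%:E)%E.
Proof.
move=> mX mY X0 Y0; rewrite unlock EFinD => Xa Yb.
under eq_integral do rewrite EFinD.
rewrite ge0_integralD//=; first exact: leeD.
- by move=> w _; rewrite lee_fin.
- exact/measurable_EFinP.
- by move=> w _; rewrite lee_fin.
- exact/measurable_EFinP.
Qed.

Lemma expectation_linear_comb n (a : 'I_n -> R) (X : 'I_n -> T -> R) :
  (forall j, X j \in Lfun Q 1) ->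
  ('E_Q[\sum_(j < n) (a j \o* X j)] = \sum_(j < n) (a j)%:E * 'E_Q[X j])%E.
Proof.
elim: n a X => [|n IH] a X X1.
  by rewrite !big_ord0; exact: expectation_cst.
rewrite !big_ord_recl expectationD ?Lfun_scale//.
  by rewrite expectationZl// IH.
by apply: rpred_sum => *; rewrite Lfun_scale.
Qed.

Lemma variance_linear_comb n (a : 'I_n -> R) (X : 'I_n -> T -> R) :
  (forall j, X j \in Lfun Q 2%:E) ->
  (forall i j, i != j -> covariance Q (X i) (X j) = 0%E) ->
  (variance Q (\sum_(j < n) (a j \o* X j))%R =
   \sum_(j < n) (a j ^+ 2)%:E * variance Q (X j))%E.
Proof.
move=> X2 cX; rewrite variance_sum_uncorrelated.
- by apply: eq_bigr => j _; rewrite varianceZ.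
- by move=> j; rewrite Lfun_scale// ler1n.
- move=> i j ij.
  have X1 k := Lfun2_Lfun1 (X2 k).
  have aX2 k : a k \o* X k \in Lfun Q 2%:E by rewrite Lfun_scale// ler1n.
  have XX := Lfun2_mul_Lfun1 (X2 i) (X2 j).
  have aX1 : a j \o* X j \in Lfun Q 1 by rewrite Lfun_scale.
  have XaX := Lfun2_mul_Lfun1 (X2 i) (aX2 j).
  by rewrite covarianceZl// covarianceZr// cX// !mule0.
Qed.

(** A coordinate of [U w - c] is dominated by the Euclidean norm, hence square integrable; adding
    the constant back stays in L2 of a probability measure. *)
Lemma Lfun2_coord d (U : T -> 'cV[R]_d) (c : 'cV[R]_d) i :
  (forall i, measurable_fun setT (fun w => U w i 0)) ->
  ('E_Q[fun w => (enorm (U w - c) ^+ 2)%R] < +oo)%E ->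
  (fun w => U w i 0) \in Lfun Q 2%:E.
Proof.
move=> mU Uc.
have mUc k : measurable_fun setT (fun w => (U w - c) k 0).
  under eq_fun do rewrite !mxE.
  by apply: measurable_funD => //; exact: measurable_cst.
have L2 : (fun w => (U w - c) i 0) \in Lfun Q 2%:E.
  apply: Lfun2_of_sqr_lty => //; apply: le_lt_trans Uc; apply: expectation_le.
  - exact: measurable_funX.
  - by apply: measurable_funX; exact: measurable_enorm.
  - by move=> w; exact: sqr_ge0.
  - by move=> w; exact: sqr_ge0.
  - apply: aeW => w; rewrite -(real_normK (num_real ((U w - c) i 0))).
    by rewrite lerXn2r ?nnegrE ?enorm_ge0// ler_coord_enorm.
have -> : (fun w => U w i 0) = (fun w => (U w - c) i 0) \+ cst (c i 0).
  by apply/funext => w; rewrite /= !mxE subrK.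
by rewrite rpredD ?lee1n// => h; exact: Lfun_cst.
Qed.

(* Split off the bias; the deviations of the independent [U j] from their means
   are uncorrelated, so that their second moments add up. *)
Lemma expectation_enorm_weighted_sum n d (a : 'cV[R]_n)
    (U : 'I_n -> T -> 'cV[R]_d) (c : 'I_n -> 'cV[R]_d) (D1 D2 : R) :
  0 <= D2 ->
  (forall j i, measurable_fun setT (fun w => U j w i 0)) ->
  (forall i j l A B, j != l -> measurable A -> measurable B ->
     Q ((fun w => U j w i 0) @^-1` A `&` (fun w => U l w i 0) @^-1` B) =
     (Q ((fun w => U j w i 0)%R @^-1` A) * Q ((fun w => U l w i 0)%R @^-1` B))%E) ->
  (forall j, enorm (vexpect Q (U j) - c j) <= D1) ->
  (forall j, 'E_Q[fun w => (enorm (U j w - c j) ^+ 2)%R] <= (D2 ^+ 2)%:E)%E ->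
  ('E_Q[fun w => enorm (\sum_(j < n) a j 0%R *: (U j w - c j))%R]
     <= (norm1 a * D1 + enorm a * D2)%:E)%E.
Proof.
move=> D20 mU indep bias dev.
have U2 j i : (fun w => U j w i 0) \in Lfun Q 2%:E.
  exact: Lfun2_coord (mU j) (le_lt_trans (dev j) (ltry _)).
have U1 j i := Lfun2_Lfun1 (U2 j i).
pose m j := vexpect Q (U j).
(* [W] is the centred part: deviations are taken from the means [m j], not from [c j], so that the
   cross terms vanish. *)
pose W w := \sum_(j < n) a j 0 *: (U j w - m j).
have WE w i : W w i 0 = \sum_(j < n) a j 0 * (U j w i 0 - m j i 0).
  by rewrite summxE; apply: eq_bigr => j _; rewrite !mxE.
have mW i : measurable_fun setT (fun w => W w i 0).
  under eq_fun do rewrite WE.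
  apply: measurable_sum => j; apply: measurable_funM => //.
  by apply: measurable_funD => //; exact: measurable_cst.
have mUc j i : measurable_fun setT (fun w => (U j w - c j) i 0).
  under eq_fun do rewrite !mxE.
  by apply: measurable_funD => //; exact: measurable_cst.
have W2 : ('E_Q[fun w => (enorm (W w) ^+ 2)%R] <= ((enorm a * D2) ^+ 2)%:E)%E.
  under eq_fun do rewrite sqr_enorm.
  rewrite expectation_sum_ge0; last 2 first.
  - by move=> i; exact: measurable_funX.
  - by move=> i w; exact: sqr_ge0.
  (* Coordinate [i] of [W] is a linear combination minus its mean, so its second moment is a
     variance. *)
  have EW i : ('E_Q[fun w => (W w i 0 ^+ 2)%R] =
      \sum_(j < n) (a j 0 ^+ 2)%R%:E * variance Q (fun w => U j w i 0)%R)%E.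
    rewrite -variance_linear_comb//; last first.
      by move=> j l jl; apply: covariance_indep => // A B mA mB; exact: indep.
    rewrite /variance covariance.unlock; congr expectation; apply/funext => w.
    rewrite expectation_linear_comb//= expr2 fct_sumE WE.
    have -> : fine (\sum_(j < n) (a j 0)%R%:E * 'E_Q[(fun w => U j w i 0)%R])%E =
        \sum_(j < n) a j 0 * m j i 0.
      rewrite -sum_fine => [|j _]; last first.
        by rewrite fin_numM// expectation_fin_num.
      apply: eq_bigr => j _; rewrite /m mxE.
      by rewrite fineM// expectation_fin_num.
    suff -> : \sum_(j < n) a j 0 * (U j w i 0 - m j i 0) =
        \sum_(j < n) U j w i 0 * a j 0 - \sum_(j < n) a j 0 * m j i 0 by [].
    by rewrite -sumrB; apply: eq_bigr => j _; rewrite mulrBr (mulrC (U _ _ _ _)).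
  under eq_bigr do rewrite EW.
  (* With the sums over coordinates and over [j] exchanged, each [j] contributes a_j^2 times the
     total variance of [U j], which is at most its second moment about [c j]. *)
  rewrite exchange_big/= exprMn sqr_enorm mulr_suml -sumEFin.
  apply: lee_sum => j _; rewrite [leRHS]EFinM -ge0_sume_distrr; last first.
    by move=> i _; exact: variance_ge0.
  rewrite lee_wpmul2l ?lee_fin ?sqr_ge0//.
  apply: le_trans (dev j).
  under [X in (_ <= expectation _ X)%E]eq_fun do rewrite sqr_enorm.
  rewrite expectation_sum_ge0; last 2 first.
  - by move=> i; exact: measurable_funX.
  - by move=> i w; exact: sqr_ge0.
  apply: lee_sum => i _; rewrite (le_trans (variance_le_sqr_dev (c j i 0) (U2 j i)))//.
  by under [X in (_ <= expectation _ X)%E]eq_fun do rewrite !mxE.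
have EW : ('E_Q[fun w => enorm (W w)] <= (enorm a * D2)%:E)%E.
  apply: expectation_le_of_sqr => //; first by rewrite mulr_ge0 ?enorm_ge0.
  - exact: measurable_enorm.
  - by move=> w; exact: enorm_ge0.
(* [bias] forces D1 >= 0 as soon as an index exists; for n = 0 the factor [norm1 a] vanishes. *)
have D10 : 0 <= norm1 a * D1.
  have [j _|n0] := pickP 'I_n.
    by rewrite mulr_ge0 ?norm1_ge0// (le_trans _ (bias j)) ?enorm_ge0.
  by rewrite /norm1 big_pred0// mul0r.
apply: (@le_trans _ _ ('E_Q[fun w => (norm1 a * D1 + enorm (W w))%R])%E).
  apply: expectation_le.
  - apply: measurable_enorm => i.
    under eq_fun do rewrite summxE.
    apply: measurable_sum => j; under eq_fun do rewrite mxE.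
    by apply: measurable_funM.
  - by apply: measurable_funD => //; exact: measurable_enorm.
  - by move=> w; exact: enorm_ge0.
  - by move=> w; rewrite addr_ge0 ?enorm_ge0.
  - apply: aeW => w.
    have -> : \sum_(j < n) a j 0 *: (U j w - c j) =
        \sum_(j < n) a j 0 *: (m j - c j) + W w.
      rewrite -big_split/=; apply: eq_bigr => j _.
      by rewrite -scalerDr [in RHS]addrC subrKA.
    rewrite (le_trans (enormD _ _))// lerD2r (le_trans (enorm_sum _))//.
    rewrite /norm1 mulr_suml; apply: ler_sum => j _.
    by rewrite enormZ ler_wpM2l//; exact: bias.
apply: (@expectationD_le (cst (norm1 a * D1))) => //.
- exact: measurable_enorm.
- by move=> w; exact: enorm_ge0.
- by rewrite expectation_cst.
Qed.

End WeightedNoise.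

(** * A recursive inequality with [n] delays *)

Section DelayRecursion.
Context {R : realType} {n : nat}.
Hypothesis n_gt0 : (0 < n)%N.

(** With r = q^(1/n) < 1 the perturbation is the geometric sequence C r^k, and the limsup is at most
    the supremum over any tail, here one starting beyond [n]. *)
Lemma limn_esup_le_powR (e : nat -> \bar R) (q L C : R) : 0 <= q < 1 ->
  (forall k, (n <= k)%N -> e k <= (L + C * q `^ (k%:R / n%:R))%:E)%E ->
  (limn_esup e <= L%:E)%E.
Proof.
move=> /andP[q0 q1] eL; apply/lee_addgt0Pr => eps eps0.
pose r := q `^ n%:R^-1.
have r0 : 0 <= r by exact: powR_ge0.
have r1 : r < 1.
  have := @gt0_ltr_powR R n%:R^-1 _ q 1; rewrite powR1; apply => //.
  - by rewrite invr_gt0 ltr0n.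
  - by rewrite nnegrE.
have rE k : q `^ (k%:R / n%:R) = r ^+ k.
  by rewrite mulrC powRrM powR_mulrn.
have : geometric C r @ \oo --> (0 : R) by apply: cvg_geometric; rewrite ger0_norm.
move=> /cvgrPdist_lt/(_ _ eps0) [N _ HN].
apply: (@le_trans _ _ (ereal_sup (e @` [set k | (maxn N n <= k)%N]))).
  by apply: ereal_inf_lbound; exists [set k | (maxn N n <= k)%N] => //; exists (maxn N n).
apply: ge_ereal_sup => _ [k + <-]; rewrite /= geq_max => /andP[Nk nk].
apply: (le_trans (eL k nk)); rewrite lee_fin lerD2l rE.
have /= := HN k Nk; rewrite sub0r normrN => /ltW; apply: le_trans.
exact: ler_norm.
Qed.

(* The steps [n <= k] lose a factor [q = gamma * norm1 a] over a window of
   length [n], which turns the recursion into decay at rate [q ^ (1 / n)]. *)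
Lemma delay_recursion (a : 'cV[R]_n) (gamma B : R) (e : nat -> \bar R) :
  0 <= gamma -> gamma * norm1 a < 1 -> 0 <= B ->
  (forall k, exists M : R, (e k <= M%:E)%E) ->
  (forall k (b : 'I_n -> R), (n <= k)%N ->
    (forall j : 'I_n, e (k - j.+1)%N <= (b j)%:E)%E ->
    (e k <= (gamma * \sum_(j < n) `|a j 0| * b j + B)%:E)%E) ->
  (norm1 a = 0 -> forall k, (0 < k)%N -> (e k <= B%:E)%E) ->
  exists C : R, 0 <= C /\ forall k, ~ (gamma = 0 /\ (0 < k < n)%N) ->
    (e k <= (B / (1 - gamma * norm1 a) + C * (gamma * norm1 a) `^ (k%:R / n%:R))%:E)%E.
Proof.
move=> g0 q1 B0 /choice[M eM] step deg.
set q := gamma * norm1 a in q1 *.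
have q0 : 0 <= q by rewrite mulr_ge0// norm1_ge0.
have p0 : 0 < 1 - q by rewrite subr_gt0.
have LB : B <= B / (1 - q).
  by rewrite ler_pdivlMr// -[leRHS]mulr1 ler_wpM2l// gerBl.
have L0 : 0 <= B / (1 - q) by rewrite divr_ge0// ltW.
(* For q = 0 the power q^(k/n) is 1 at k = 0 and 0 afterwards: [C] absorbs the error at time 0, and
   each later error in question has to be at most [B]. *)
have [qE|qN] := eqVneq q 0.
  exists `|M 0%N|; split => // -[_|k kn].
    apply: (le_trans (eM 0%N)); rewrite mul0r powRr0 mulr1 lee_fin.
    by rewrite (le_trans (ler_norm _))// lerDr.
  suff h : (e k.+1 <= B%:E)%E.
    by rewrite (le_trans h)// lee_fin (le_trans LB)// lerDl mulr_ge0// powR_ge0.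
  (* If gamma is nonzero then [norm1 a] is 0 and [deg] applies. If gamma = 0, the excluded range
     leaves only indices from [n] on, where [step] yields [B]. *)
  have [g00|gN] := eqVneq gamma 0; last first.
    by apply: deg => //; apply/eqP; move/eqP: qE; rewrite mulf_eq0 (negbTE gN).
  have nk : (n <= k.+1)%N by rewrite leqNgt; apply/negP => ?; exact: kn.
  have := step _ (fun j => M (k.+1 - j.+1)%N) nk (fun j => eM _).
  by rewrite g00 mul0r add0r.
have qp : 0 < q by rewrite lt_neqAle eq_sym qN.
have q01 : 0 < q <= 1 by rewrite qp ltW.
(* For k < n the power q^(k/n) is at least q, so the division by [q] lets C q^(k/n) cover all the
   initial bounds [M k]. *)
pose C := (\sum_(k < n) `|M k|) / q.
have C0 : 0 <= C by rewrite divr_ge0// sumr_ge0.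
exists C; split => // k _.
have nR : 0 < n%:R :> R by rewrite ltr0n.
elim/ltn_ind: k => k IH.
have [kn|nk] := ltnP k n.
  apply: (le_trans (eM k)); rewrite lee_fin (@le_trans _ _ (C * q))//.
    rewrite /C divfK// (le_trans (ler_norm _))//.
    by rewrite (bigD1 (Ordinal kn))//= lerDl sumr_ge0.
  rewrite (@le_trans _ _ (C * q `^ (k%:R / n%:R)))//; last by rewrite lerDr.
  by rewrite ler_wpM2l// ger1_powR// ler_pdivrMr// mul1r ler_nat ltnW.
have kpos : (0 < k)%N := leq_trans n_gt0 nk.
(* [D] is the bound at the oldest index k - n, hence the largest over the window. The recursion then
   closes with equality: q D + B is the bound at [k], since q q^((k-n)/n) = q^(k/n). *)
pose D := B / (1 - q) + C * q `^ ((k - n)%:R / n%:R).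
apply: (le_trans (step k (fun=> D) nk _)).
  move=> j; apply: (le_trans (IH _ _)); first by rewrite ltn_subrL kpos.
  rewrite lee_fin lerD2l ler_wpM2l// ger_powR// ler_wpM2r ?invr_ge0 ?ler0n//.
  by rewrite ler_nat leq_sub2l.
rewrite lee_fin -mulr_suml mulrA -/(norm1 a) -/q /D.
have -> : q `^ (k%:R / n%:R) = q * q `^ ((k - n)%:R / n%:R).
  rewrite -{2}(powRr1 q0) -powRD ?(negbTE qN) ?implybT//.
  by congr (_ `^ _); rewrite natrB// mulrBl divff ?gt_eqF// addrC subrK.
rewrite le_eqVlt; apply/orP; left; apply/eqP.
by field; rewrite gt_eqF.
Qed.

End DelayRecursion.

(** * Error estimates for the prediction-correction iterates *)

Section PredictionCorrection.
Context {disp : measure_display} {T : measurableType disp} {R : realType}.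
Context {d n : nat}.
Variables (Q : probability T R) (a : 'cV[R]_n) (z : nat -> T -> 'cV[R]_d).
Variables (x : int -> T -> 'cV[R]_d) (x0 : 'cV[R]_d) (xs : int -> 'cV[R]_d).
Variables (gamma D1 D2 D3 : R).
Hypothesis n_gt0 : (0 < n)%N.
Hypothesis measurable_z : forall k i, measurable_fun setT (fun w => z k w i 0).
Hypothesis indep_z : forall k l i A B, k != l -> measurable A -> measurable B ->
  Q ((fun w => z k w i 0) @^-1` A `&` (fun w => z l w i 0) @^-1` B) =
  (Q ((fun w => z k w i 0)%R @^-1` A) * Q ((fun w => z l w i 0)%R @^-1` B))%E.
Hypothesis x_init : forall j : int, - n%:Z < j -> j <= 0 -> forall w, x j w = x0.
Hypothesis measurable_x :
  forall (k : nat) i, measurable_fun setT (fun w => x k%:Z w i 0).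
Hypotheses (gamma_ge0 : 0 <= gamma) (D2_ge0 : 0 <= D2).

Let xhat (k : nat) (w : T) : 'cV[R]_d := prediction a (fun j => x j w) k.
Let err (k : nat) : \bar R := ('E_Q[fun w => enorm (xhat k w - xs k%:Z)%R])%E.

Hypothesis x_correction : forall k : nat, {ae Q, forall w,
  enorm (x k%:Z w - z k w) <= gamma * enorm (xhat k w - z k w)}.
Hypothesis z_bias : forall k : nat, enorm (vexpect Q (z k) - xs k%:Z) <= D1.
Hypothesis z_dev : forall k : nat,
  ('E_Q[fun w => (enorm (z k w - xs k%:Z) ^+ 2)%R] <= (D2 ^+ 2)%:E)%E.
Hypothesis xs_drift : forall k : nat,
  enorm (history n xs k *m a - xs k%:Z) <= D3.

Lemma prediction_sum k w : (0 < k)%N ->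
  xhat k w = \sum_(j < n) a j 0 *: x (k%:Z - j.+1%:Z) w.
Proof. by case: k => // k _; exact: (history_mulmx (fun j => x j w)). Qed.

(** The oldest index is k - n >= 1 - n, so indices that are not positive fall in the range of
    [x_init]. *)
Lemma lag_gt k (j : 'I_n) : (0 < k)%N -> - n%:Z < k%:Z - j.+1%:Z.
Proof. by have := ltn_ord j; lia. Qed.

Lemma lag_nat k (j : 'I_n) : (n <= k)%N -> k%:Z - j.+1%:Z = (k - j.+1)%N%:Z.
Proof. by have := ltn_ord j; lia. Qed.

Lemma measurable_iterate (j : int) i : - n%:Z < j ->
  measurable_fun setT (fun w => x j w i 0).
Proof.
case: j => [m|m] nj; first exact: measurable_x.
by under eq_fun do rewrite x_init//; exact: measurable_cst.
Qed.

Lemma measurable_enorm_sub (U : T -> 'cV[R]_d) (c : 'cV[R]_d) :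
  (forall i, measurable_fun setT (fun w => U w i 0)) ->
  measurable_fun setT (fun w => enorm (U w - c)).
Proof.
move=> mU; apply: measurable_enorm => i; under eq_fun do rewrite !mxE.
by apply: measurable_funD => //; exact: measurable_cst.
Qed.

Lemma measurable_prediction k i : measurable_fun setT (fun w => xhat k w i 0).
Proof.
have [->|k0] := posnP k; first exact: measurable_x.
under eq_fun do rewrite prediction_sum// summxE.
apply: measurable_sum => j; under eq_fun do rewrite mxE.
by apply: measurable_funM => //; apply: measurable_iterate; exact: lag_gt.
Qed.

Let mxhat k := measurable_enorm_sub (xs k%:Z) (measurable_prediction k).
Let mz k := measurable_enorm_sub (xs k%:Z) (measurable_z k).

Lemma expectation_sample_dev k :
  ('E_Q[fun w => enorm (z k w - xs k%:Z)] <= D2%:E)%E.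
Proof.
by apply: expectation_le_of_sqr => // w; exact: enorm_ge0.
Qed.

(** Triangle inequality through [xs], which trades the distance from prediction to sample minimizer
    for the prediction error and the sample deviation. *)
Lemma correction_le k : {ae Q, forall w, enorm (x k%:Z w - z k w) <=
  gamma * (enorm (xhat k w - xs k%:Z) + enorm (z k w - xs k%:Z))}.
Proof.
apply: filterS (x_correction k) => w /le_trans; apply.
by rewrite ler_wpM2l// -(enormN (z k w - _)) opprB enormB.
Qed.

(** A crude bound that serves the finiteness of the errors; its constants do not reach the final
    estimate. *)
Lemma tracking_error_le k (M : R) : (err k <= M%:E)%E ->
  ('E_Q[fun w => enorm (x k%:Z w - xs k%:Z)] <= (gamma * (M + D2) + D2)%:E)%E.
Proof.
move=> kM.
apply: (@le_trans _ _ ('E_Q[fun w => (gamma * (enorm (xhat k w - xs k%:Z)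
    + enorm (z k w - xs k%:Z)) + enorm (z k w - xs k%:Z))%R])%E).
  apply: expectation_le.
  - exact: measurable_enorm_sub.
  - by apply: measurable_funD => //; apply: measurable_funM => //; exact: measurable_funD.
  - by move=> w; exact: enorm_ge0.
  - by move=> w; rewrite !(addr_ge0, mulr_ge0) ?enorm_ge0.
  - apply: filterS (correction_le k) => w h.
    by rewrite (le_trans (enormB _ (z k w) _))// lerD2r.
apply: expectationD_le => //.
- by apply: measurable_funM => //; exact: measurable_funD.
- by move=> w; rewrite !(addr_ge0, mulr_ge0) ?enorm_ge0.
- by move=> w; exact: enorm_ge0.
- apply: expectationZ_le => //; first exact: measurable_funD.
    by move=> w; rewrite addr_ge0 ?enorm_ge0.
  apply: expectationD_le => //; try by move=> w; exact: enorm_ge0.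
  exact: expectation_sample_dev.
- exact: expectation_sample_dev.
Qed.

(** Covers every k > 0, including windows that reach negative indices, at the price of ignoring
    cancellation in the noise. *)
Lemma prediction_error_le k (b : 'I_n -> R) : (0 < k)%N ->
  (forall j : 'I_n, 'E_Q[fun w =>
     enorm (x (k%:Z - j.+1%:Z)%R w - xs (k%:Z - j.+1%:Z)%R)%R] <= (b j)%:E)%E ->
  (err k <= (\sum_(j < n) `|a j 0| * b j + D3)%:E)%E.
Proof.
move=> k0 xb.
have mxj (j : 'I_n) : measurable_fun setT
    (fun w => enorm (x (k%:Z - j.+1%:Z) w - xs (k%:Z - j.+1%:Z))).
  by apply: measurable_enorm_sub => i; apply: measurable_iterate; exact: lag_gt.
have D30 : 0 <= D3 := le_trans (enorm_ge0 _) (xs_drift 0).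
apply: (@le_trans _ _ ('E_Q[fun w => (\sum_(j < n) `|a j 0%R| *
    enorm (x (k%:Z - j.+1%:Z) w - xs (k%:Z - j.+1%:Z)) + D3)%R])%E).
  apply: expectation_le => //.
  - by apply: measurable_funD => //; apply: measurable_sum => j; exact: measurable_funM.
  - by move=> w; exact: enorm_ge0.
  - by move=> w; rewrite addr_ge0// sumr_ge0// => j _; rewrite mulr_ge0 ?enorm_ge0.
  - apply: aeW => w; rewrite (le_trans (enormB _ (history n xs k *m a) _))// lerD//.
    rewrite prediction_sum// history_mulmx -sumrB (le_trans (enorm_sum _))//.
    by apply: ler_sum => j _; rewrite -scalerBr enormZ.
apply: (@expectationD_le _ _ _ _ _ (cst D3)) => //.
- by apply: measurable_sum => j; exact: measurable_funM.
- by move=> w; rewrite sumr_ge0// => j _; rewrite mulr_ge0 ?enorm_ge0.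
- by apply: expectation_weighted_sum_le => // j w; exact: enorm_ge0.
- by rewrite expectation_cst.
Qed.

(** Strong induction: each column of the history is either an earlier iterate or the constant [x0].
    The bounds obtained supply the constant of the delay recursion. *)
Lemma prediction_error_finite k : exists M : R, (err k <= M%:E)%E.
Proof.
elim/ltn_ind: k => k IH.
have [->|k0] := posnP k.
  exists (enorm (x0 - xs 0)); rewrite /err.
  under eq_fun do rewrite /xhat/= x_init ?lexx ?oppr_lt0//.
  by rewrite expectation_cst.
have /choice[b xb] : forall j : 'I_n, exists M : R, ('E_Q[fun w =>
     enorm (x (k%:Z - j.+1%:Z)%R w - xs (k%:Z - j.+1%:Z)%R)%R] <= M%:E)%E.
  move=> j; have [jk|kj] := ltnP j k.
    have [|M hM] := IH (k - j.+1)%N; first by rewrite ltn_subrL.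
    rewrite subzn//; exists (gamma * (M + D2) + D2); exact: tracking_error_le.
  exists (enorm (x0 - xs (k%:Z - j.+1%:Z))).
  under eq_fun do rewrite x_init ?lag_gt ?subr_le0 ?lez_nat ?(leq_trans kj)//.
  by rewrite expectation_cst.
by exists (\sum_(j < n) `|a j 0| * b j + D3); exact: prediction_error_le.
Qed.

(** For k >= n all indices of the window are natural numbers, so each column has its own sample and
    correction estimate. *)
Lemma prediction_error_recursion k (b : 'I_n -> R) : (n <= k)%N ->
  (forall j : 'I_n, err (k - j.+1)%N <= (b j)%:E)%E ->
  (err k <= (gamma * \sum_(j < n) `|a j 0| * b j + (norm1 a * D1 +
     (gamma * norm1 a + enorm a) * D2 + D3))%:E)%E.
Proof.
move=> nk eb.
have k0 : (0 < k)%N := leq_trans n_gt0 nk.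
have D30 : 0 <= D3 := le_trans (enorm_ge0 _) (xs_drift 0).
(* gamma times [F j] bounds the correction error of a column, and [N] is the weighted noise of the
   sample minimizers. *)
pose F (j : 'I_n) w := enorm (xhat (k - j.+1) w - xs (k - j.+1)%N%:Z)
  + enorm (z (k - j.+1)%N w - xs (k - j.+1)%N%:Z).
pose N w := \sum_(j < n) a j 0 *: (z (k - j.+1)%N w - xs (k - j.+1)%N%:Z).
have mF j : measurable_fun setT (F j) by exact: measurable_funD.
have F0 j w : 0 <= F j w by rewrite addr_ge0 ?enorm_ge0.
have mN : measurable_fun setT (fun w => enorm (N w)).
  apply: measurable_enorm => i; under eq_fun do rewrite summxE.
  apply: measurable_sum => j; under eq_fun do rewrite !mxE.
  by apply: measurable_funM => //; apply: measurable_funD => //; exact: measurable_cst.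
apply: (@le_trans _ _ ('E_Q[fun w => ((\sum_(j < n) (gamma * `|a j 0%R|) * F j w
    + enorm (N w)) + D3)%R])%E).
  apply: expectation_le => //.
  - apply: measurable_funD => //; apply: measurable_funD => //.
    by apply: measurable_sum => j; exact: measurable_funM.
  - by move=> w; exact: enorm_ge0.
  - move=> w; rewrite !addr_ge0 ?enorm_ge0// sumr_ge0// => j _.
    by rewrite !mulr_ge0.
  (* Countably many almost sure estimates hold simultaneously almost surely, so all columns are
     treated at one [w]. *)
  - apply: filterS (ae_foralln correction_le) => w corr.
    rewrite (le_trans (enormB _ (history n xs k *m a) _))// lerD//.
    rewrite prediction_sum// history_mulmx.
    have -> : \sum_(j < n) a j 0 *: x (k%:Z - j.+1%:Z) w -
        \sum_(j < n) a j 0 *: xs (k%:Z - j.+1%:Z) =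
        \sum_(j < n) a j 0 *: (x (k - j.+1)%N%:Z w - z (k - j.+1)%N w) + N w.
      rewrite -sumrB -big_split/=; apply: eq_bigr => j _.
      by rewrite -scalerBr -scalerDr subrKA lag_nat.
    rewrite (le_trans (enormD _ _))// lerD2r (le_trans (enorm_sum _))//.
    apply: ler_sum => j _; rewrite enormZ -mulrA mulrCA ler_wpM2l//; exact: corr.
have -> : gamma * (\sum_(j < n) `|a j 0| * b j) + (norm1 a * D1 +
     (gamma * norm1 a + enorm a) * D2 + D3) =
   (\sum_(j < n) (gamma * `|a j 0|) * (b j + D2) + (norm1 a * D1 + enorm a * D2)) + D3.
  under [in RHS]eq_bigr do rewrite -mulrA mulrDr.
  rewrite -[in RHS]mulr_sumr big_split/= -mulr_suml -/(norm1 a); ring.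
apply: (@expectationD_le _ _ _ _ _ (cst D3)) => //.
- by apply: measurable_funD => //; apply: measurable_sum => j; exact: measurable_funM.
- move=> w; rewrite addr_ge0 ?enorm_ge0// sumr_ge0// => j _.
  by rewrite !mulr_ge0.
- apply: expectationD_le => //.
  + by apply: measurable_sum => j; exact: measurable_funM.
  + by move=> w; rewrite sumr_ge0// => j _; rewrite !mulr_ge0.
  + by move=> w; exact: enorm_ge0.
  + apply: expectation_weighted_sum_le => // j; first by rewrite mulr_ge0.
    apply: expectationD_le => //; try by move=> w; exact: enorm_ge0.
      exact: eb.
    exact: expectation_sample_dev.
  + apply: (@expectation_enorm_weighted_sum _ _ _ _ _ _ _
      (fun j w => z (k - j.+1)%N w)) => // i j l A B jl; apply: indep_z.
    (* Distinct columns use distinct samples: the truncated subtraction is injective here because j,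
       l < n <= k. *)
    by apply: contra_neq jl => jl; apply/val_inj => /=;
      have := ltn_ord j; have := ltn_ord l; lia.
- by rewrite expectation_cst.
Qed.

(** All weights vanish, so the prediction coincides with the one made from [xs], and only the drift
    remains. *)
Lemma prediction_error_alpha0 k : norm1 a = 0 -> (0 < k)%N -> (err k <= D3%:E)%E.
Proof.
move=> a0 k0; have aE j : a j 0 = 0.
  apply/eqP; rewrite -normr_eq0; move/eqP: a0; rewrite psumr_eq0//.
  by move=> /allP/(_ j (mem_index_enum _)).
have xhatE w : xhat k w = history n xs k *m a.
  by rewrite prediction_sum// history_mulmx; apply: eq_bigr => j _; rewrite aE !scale0r.
rewrite /err; under eq_fun do rewrite xhatE.
by rewrite expectation_cst lee_fin.
Qed.

End PredictionCorrection.

(** * The tracking bound and its limsup *)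

Theorem mainTheorem1 (R : realType) (d dy p n : nat)
  (* the stochastic time-varying problem *)
  (P : R -> probability (borelVec R dy) R)
  (l : 'cV[R]_d -> 'cV[R]_dy -> R) (psi : 'cV[R]_d -> \bar R)
  (l_diff : forall x y, differentiable (fun x' : 'cV[R]_d => l x' y) x)
  (xstar : R -> 'cV[R]_d)
  (xstarP : forall t : R, 0 <= t -> is_argmin (objective P l psi t) (xstar t))
  (h : R) (h_gt0 : 0 < h)
  (* x^*_k; the vectors of negative index are arbitrary *)
  (xs : int -> 'cV[R]_d)
  (xsE : forall k : nat, xs k%:Z = xstar (k%:R * h))
  (* the samples, and the minimizers of the sampled objectives *)
  (disp : measure_display) (Omega : measurableType disp)
  (Pr : probability Omega R)
  (y : nat -> Omega -> borelVec R dy)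
  (y_law : forall k : nat, has_law Pr (y k) (P (k%:R * h)))
  (y_indep : mutually_independent Pr y)
  (argmin_sample : borelVec R dy -> borelVec R d)
  (argmin_sampleP :
    forall z, is_argmin (sample_objective l psi z) (argmin_sample z))
  (argmin_sample_meas : measurable_fun setT argmin_sample)
  (* the coefficients *)
  (p_gt0 : (0 < p)%N) (p_le_n : (p <= n)%N)
  (phi : R -> 'cV[R]_p) (Phi_full : row_free (Phi_mx n phi))
  (* the iterates *)
  (x0 : 'cV[R]_d) (x : int -> Omega -> borelVec R d)
  (x_init : forall j : int, - n%:Z < j -> j <= 0 -> forall w, x j w = x0)
  (x_meas : forall k : nat, measurable_fun setT (x k%:Z))
  (* the constants *)
  (sigma1 mu L20 gamma Delta1 Delta2 Delta3 : R) :
  let alpha : 'cV[R]_n := coef n phi in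
  let xhat (k : nat) (w : Omega) : 'cV[R]_d :=
    prediction alpha (fun j => x j w) k in
  let xhs (k : nat) (w : Omega) : 'cV[R]_d := argmin_sample (y k w) in
  let e (k : nat) : \bar R := ('E_Pr[fun w => enorm (xhat k w - xs k%:Z)%R])%E in
  let bound : R :=
    (norm1 alpha * Delta1 + (gamma * norm1 alpha + enorm alpha) * Delta2
      + Delta3) / (1 - gamma * norm1 alpha) in
  0 <= sigma1 -> 0 < mu -> 0 < L20 ->
  (* (1) *)
  (forall (t : R) (u : 'cV[R]_d), 0 <= t ->
     (P t).-integrable setT (fun z => (l u z)%:E) /\
     (P t).-integrable setT
       (fun z => (enorm (grad (fun u' => l u' z) u))%:E)) ->
  (* (2) *)
  (forall k : nat,
     ('E_(P (k%:R * h)%R)[fun z =>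
        (enorm (grad (fun u => l u z) (xs k%:Z)
           - vexpect (P (k%:R * h)) (fun z' => grad (fun u => l u z') (xs k%:Z)))
        ^+ 2)%R] <= (sigma1 ^+ 2)%:E)%E) ->
  (* (3), (4), (5) *)
  (forall z, strongly_convex mu (fun u => l u z)) ->
  (forall z, smooth L20 (fun u => l u z)) ->
  proper_fun psi -> closed_fun psi -> convex_fun psi ->
  (* in \bar R the inverse of 0 is +oo *)
  0 <= gamma -> (gamma%:E < ((norm1 alpha)%:E)^-1)%E ->
  0 <= Delta1 -> 0 <= Delta2 -> 0 <= Delta3 ->
  (* (6) *)
  (forall k : nat, {ae Pr, forall w,
     enorm (x k%:Z w - xhs k w : 'cV[R]_d) <= gamma * enorm (xhat k w - xhs k w)}) ->
  (* (7) *)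
  (forall k : nat,
     enorm (vexpect Pr (xhs k) - xs k%:Z) <= Delta1 /\
     ('E_Pr[fun w => (enorm (xhs k w - xs k%:Z) ^+ 2)%R]
        <= (Delta2 ^+ 2)%:E)%E) ->
  (* (8) *)
  (forall k : nat, enorm (history n xs k *m alpha - xs k%:Z) <= Delta3) ->
  (* For gamma = 0 and 0 < k < n the term C * 0 `^ (k / n) vanishes, and the
     first estimate fails because x_{-1}, ..., x_{1-n} are unrelated to the
     arbitrary x^*_{-1}, ..., x^*_{1-n}. *)
  (exists C : R, 0 <= C /\
     forall k : nat, ~ (gamma = 0 /\ (0 < k < n)%N) ->
       (e k <= (bound + C * (gamma * norm1 alpha) `^ (k%:R / n%:R))%:E)%E)
  /\ (limn_esup e <= bound%:E)%E.
Proof.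
move=> a xhat z e bound _ _ _ _ _ _ _ _ _ _ g0 ga D10 D20 D30 corr dev drift.
have n_gt0 : (0 < n)%N := leq_trans p_gt0 p_le_n.
have my k i : measurable_fun setT (fun w => (argmin_sample (y k w) : 'cV[R]_d) i 0).
  apply: (measurableT_comp (measurable_coord i)).
  exact: measurableT_comp argmin_sample_meas (y_law k).1.
have indep k m i A B : k != m -> measurable A -> measurable B ->
    Pr ((fun w => z k w i 0) @^-1` A `&` (fun w => z m w i 0) @^-1` B) =
    (Pr ((fun w => z k w i 0)%R @^-1` A) * Pr ((fun w => z m w i 0)%R @^-1` B))%E.
  move=> km mA mB.
  pose g v := (argmin_sample v : 'cV[R]_d) i 0.
  have mg : measurable_fun setT g.
    exact: measurableT_comp (measurable_coord i) argmin_sample_meas.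
  (* Mutual independence takes a family of events over all indices; only its values at [k] and [m]
     enter. *)
  pose S j := if j == k then g @^-1` A else g @^-1` B.
  have mS j : measurable (S j).
    by rewrite /S; case: ifP => _; rewrite -[X in measurable X]setTI; apply: mg.
  have := y_indep [:: k; m] S; rewrite /= inE km => /(_ erefl mS).
  rewrite !big_cons big_nil mule1 /S eqxx eq_sym (negbTE km) => <-.
  congr (Pr _); apply/seteqP; split => [w [Aw Bw] j /=|w H].
    rewrite !inE => /orP[/eqP->|/eqP->]; first by rewrite eqxx.
    by rewrite eq_sym (negbTE km).
  split.
  - by have := H k; rewrite /= !inE eqxx; apply.
  - by have := H m; rewrite /= !inE eqxx orbT eq_sym (negbTE km); apply.
have mx (k : nat) i : measurable_fun setT (fun w => (x k%:Z w : 'cV[R]_d) i 0).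
  exact: measurableT_comp (measurable_coord i) (x_meas k).
(* For [norm1 a] = 0 the upper bound on gamma is +oo, but then the product is 0. *)
have q1 : gamma * norm1 a < 1.
  have [a0|a0] := eqVneq (norm1 a) 0; first by rewrite a0 mulr0.
  move: ga; rewrite inver (negbTE a0) lte_fin.
  by rewrite -ltr_pdivlMr ?div1r// lt_neqAle eq_sym a0 norm1_ge0.
have q0 : 0 <= gamma * norm1 a by rewrite mulr_ge0 ?norm1_ge0.
have bias k := (dev k).1.
have dev2 k := (dev k).2.
have [C [C0 HC]] : exists C : R, 0 <= C /\
    forall k : nat, ~ (gamma = 0 /\ (0 < k < n)%N) ->
    (e k <= (bound + C * (gamma * norm1 a) `^ (k%:R / n%:R))%:E)%E.
  apply: (delay_recursion n_gt0 (a := a)) => //.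
  - by rewrite !addr_ge0 ?mulr_ge0 ?addr_ge0 ?norm1_ge0 ?enorm_ge0.
  - move=> k; exact: (prediction_error_finite (d := d) (Q := Pr) (a := a) (z := z)
      (x := x) (xs := xs) n_gt0 my x_init mx g0 D20 corr dev2 drift k).
  - move=> k b; exact: (prediction_error_recursion (d := d) (Q := Pr) (a := a) (z := z)
      (x := x) (xs := xs) n_gt0 my indep x_init mx g0 D20 corr bias dev2 drift).
  - move=> a0 k k0; apply: (@le_trans _ _ Delta3%:E).
      exact: (prediction_error_alpha0 (a := a) Pr x drift a0 k0).
    by rewrite lee_fin lerDr addr_ge0 ?mulr_ge0 ?addr_ge0 ?norm1_ge0 ?enorm_ge0.
split; first by exists C.
apply: (limn_esup_le_powR n_gt0 (q := gamma * norm1 a) (C := C)).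
  by rewrite q0.
(* Indices from [n] on lie outside the excluded range. *)
by move=> k nk; apply: HC => -[_ /andP[_]]; rewrite ltnNge nk.
Qed.
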